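(* Let $0<\mu<L$ and $\beta=\frac{1-\sqrt{\mu/L}}{1+\sqrt{\mu/L}}$. Consider the optimization problem in the real variables $\rho_0,\rho_1,\sigma_0,\sigma_1$ and $h>0$: $$\begin{array}{ll}\text{minimize} & \max\{\rho_0+\mu h\sigma_0,\ \rho_0+Lh\sigma_0\}\\ \text{subject to} & \rho_1=-(1+\rho_0),\quad \sigma_1=1-\rho_0-\sigma_0,\quad |\rho_0|<1,\\ & (\rho_1+\mu h\sigma_1)^2\le 4(\rho_0+\mu h\sigma_0),\\ & (\rho_1+Lh\sigma_1)^2\le 4(\rho_0+Lh\sigma_0).\end{array}$$ Then an optimal solution is given by $$\rho_0=\beta^2,\quad \rho_1=-(1+\beta^2),\quad \sigma_0=0,\quad \sigma_1=1-\beta^2,\quad h=\frac{1}{\sqrt{\mu L}},$$ that is, by the two-step method $\rho(z)=\beta^2-(1+\beta^2)z+z^2$, $\sigma(z)=(1-\beta^2)z$ with step size $h=1/\sqrt{\mu L}$. The optimal value is $\beta^2$, so that the corresponding rate of convergence (the square root of the optimal value) is $\beta$.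
   Context: The constraints encode explicit, consistent, zero-stable linear two-step methods $\rho(z)=\rho_0+\rho_1z+z^2$, $\sigma(z)=\sigma_0+\sigma_1z$ with step size $h$. The last two constraints ensure that $\rho+\lambda h\sigma$ has complex conjugate roots (possibly a double real root) for every $\lambda\in[\mu,L]$, and the objective is the largest squared modulus of these roots over $\lambda\in[\mu,L]$. *)

(* Defs.v *)
From HB Require Import structures.
From mathcomp Require Import all_boot all_order all_algebra.
From mathcomp Require Import classical_sets reals.

Set Implicit Arguments.
Unset Strict Implicit.
Unset Printing Implicit Defensive.

Import Order.TTheory GRing.Theory Num.Theory.
Local Open Scope classical_set_scope.
Local Open Scope ring_scope.

(* The coefficients of rho(z) = rho0 + rho1 z + z^2 and
   sigma(z) = sigma0 + sigma1 z, together with the step size h. *)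
Record two_step (R : realType) := TwoStep {
  rho0 : R; rho1 : R; sigma0 : R; sigma1 : R; step : R
}.

Definition rho_poly (R : realType) (m : two_step R) : {poly R} :=
  (rho0 m)%:P + rho1 m *: 'X + 'X^2.

Definition sigma_poly (R : realType) (m : two_step R) : {poly R} :=
  (sigma0 m)%:P + sigma1 m *: 'X.

Definition feasible (R : realType) (mu L : R) : set (two_step R) :=
  [set m | [/\ 0 < step m,
               rho1 m = - (1 + rho0 m),
               sigma1 m = 1 - rho0 m - sigma0 m &
               `|rho0 m| < 1]
           /\ (rho1 m + mu * step m * sigma1 m) ^+ 2
                <= 4 * (rho0 m + mu * step m * sigma0 m)
           /\ (rho1 m + L * step m * sigma1 m) ^+ 2
                <= 4 * (rho0 m + L * step m * sigma0 m)].

Definition objective (R : realType) (mu L : R) (m : two_step R) : R :=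
  Num.max (rho0 m + mu * step m * sigma0 m) (rho0 m + L * step m * sigma0 m).

Definition optimal_solution (R : realType) (mu L : R) (m : two_step R) : Prop :=
  feasible mu L m /\
  forall m', feasible mu L m' -> objective mu L m <= objective mu L m'.

(* [inf] is a junk value on sets that are empty or unbounded below; neither
   occurs when an optimal solution exists. *)
Definition optimal_value (R : realType) (mu L : R) : R :=
  inf [set objective mu L m | m in feasible mu L].

Definition convergence_rate (R : realType) (mu L : R) : R :=
  Num.sqrt (optimal_value mu L).

(* Main.v *)
(** If a method is feasible then [rho(1) = 0], so at every [lambda] the polynomial
    [z^2 + p z + c = rho + lambda h sigma] takes the value
    [1 + p + c = lambda h (1 - rho0)] at [z = 1].  Where [p^2 <= 4 c] and
    [c <= r^2] with [r <= 1], this value lies between [(1 - r)^2] and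
    [(1 + r)^2].  Comparing [lambda = mu] with [lambda = L] gives
    [L (1 - r)^2 <= mu (1 + r)^2], which solves to [beta <= r]. *)
Require Import Defs.
From HB Require Import structures.
From mathcomp Require Import all_boot all_order all_algebra.
From mathcomp Require Import classical_sets reals.
From mathcomp Require Import ring lra.

Set Implicit Arguments.
Unset Strict Implicit.
Unset Printing Implicit Defensive.

Import Order.TTheory GRing.Theory Num.Theory.
Local Open Scope ring_scope.

(** With [w] the square root of [c], the discriminant condition reads [|p| <= 2 * w], which places
    [1 + p + c] between [(1 - w) ^+ 2] and [(1 + w) ^+ 2]. Since [w <= r <= 1], replacing [w] by [r]
    only widens this interval. *)
Lemma quadratic_at1_bounds (R : rcfType) (p c r : R) :
    0 <= r -> r <= 1 -> p ^+ 2 <= 4 * c -> c <= r ^+ 2 ->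
  (1 - r) ^+ 2 <= 1 + p + c /\ 1 + p + c <= (1 + r) ^+ 2.
Proof.
move=> r0 r1 disc cr.
have c0 : 0 <= c by have := sqr_ge0 p; lra.
have w0 := sqrtr_ge0 c; have wE := sqr_sqrtr c0.
set w := Num.sqrt c in w0 wE.
have wr : w <= r by rewrite -(@ler_pXn2r _ 2) // wE.
have : `|p| <= 2 * w.
  rewrite -(@ler_pXn2r _ 2) // ?nnegrE ?mulr_ge0 //.
  by rewrite real_normK ?num_real // exprMn wE; lra.
rewrite ler_norml => /andP[pl pu].
by split; rewrite -wE; nra.
Qed.

(** The lower bound is kept at [mu] and the upper one at [L]: they share the factor
    [step m * (1 - rho0 m)], which can then be eliminated. *)
Lemma feasible_at1_bounds (R : realType) (mu L : R) (m : two_step R) (r : R) :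
    feasible mu L m -> 0 <= r -> r <= 1 -> objective mu L m <= r ^+ 2 ->
  (1 - r) ^+ 2 <= mu * (step m * (1 - rho0 m)) /\
  L * (step m * (1 - rho0 m)) <= (1 + r) ^+ 2.
Proof.
case=> -[_ e1 e2 _] [dmu dL] r0 r1; rewrite /objective ge_max => /andP[cmu cL].
have [lo _] := quadratic_at1_bounds r0 r1 dmu cmu.
have [_ hi] := quadratic_at1_bounds r0 r1 dL cL.
by rewrite e1 e2 in lo hi; split; lra.
Qed.

Lemma objective_ge0 (R : realType) (mu L : R) (m : two_step R) :
  feasible mu L m -> 0 <= objective mu L m.
Proof.
case=> _ [dmu _]; rewrite /objective le_max; apply/orP; left.
by have := le_trans (sqr_ge0 _) dmu; lra.
Qed.

(** Writing [mu] as [s ^+ 2 * L] turns the comparison of the two bounds into one between squares,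
    whose root is the linear inequality [1 - r <= s * (1 + r)]. *)
Lemma feasible_objective_ge (R : realType) (s L : R) (m : two_step R) :
    0 < s -> s < 1 -> 0 < L -> feasible (s ^+ 2 * L) L m ->
  ((1 - s) / (1 + s)) ^+ 2 <= objective (s ^+ 2 * L) L m.
Proof.
move=> s0 s1 L0 fm; have o0 := objective_ge0 fm.
rewrite -(sqr_sqrtr o0); set r := Num.sqrt _.
have r0 : 0 <= r := sqrtr_ge0 _.
rewrite ler_pXn2r ?nnegrE ?divr_ge0 //; try lra.
rewrite ler_pdivrMr; last lra.
(* For [r > 1] the claim is immediate, as [(1 - s) / (1 + s) < 1]. *)
have [r1|r1] := leP r 1; last nra.
have [|lo hi] := feasible_at1_bounds fm r0 r1; first by rewrite sqr_sqrtr.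
have : (1 - r) ^+ 2 <= (s * (1 + r)) ^+ 2.
  rewrite exprMn (le_trans lo) // -mulrA ler_wpM2l ?sqr_ge0 //.
rewrite ler_pXn2r ?nnegrE ?mulr_ge0 //; lra.
Qed.

Lemma optimal_valueE (R : realType) (mu L : R) (m : two_step R) :
  optimal_solution mu L m -> optimal_value mu L = objective mu L m.
Proof.
case=> fm min_m; apply/eqP; rewrite eq_le; apply/andP; split.
- apply: ge_inf; last by exists m.
  by exists (objective mu L m) => _ [m' fm' <-]; exact: min_m.
- apply: lb_le_inf; first by exists (objective mu L m), m.
  by move=> _ [m' fm' <-]; exact: min_m.
Qed.

Theorem mainTheorem3 (R : realType) (mu L beta : R) (mu_gt0 : 0 < mu)
    (mu_ltL : mu < L)
    (beta_def : beta = (1 - Num.sqrt (mu / L)) / (1 + Num.sqrt (mu / L))) :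
  let opt := {| rho0 := beta ^+ 2; rho1 := - (1 + beta ^+ 2);
                sigma0 := 0; sigma1 := 1 - beta ^+ 2;
                step := 1 / Num.sqrt (mu * L) |} in
  [/\ optimal_solution mu L opt,
      rho_poly opt = (beta ^+ 2)%:P - (1 + beta ^+ 2) *: 'X + 'X^2,
      sigma_poly opt = (1 - beta ^+ 2) *: 'X,
      optimal_value mu L = beta ^+ 2 &
      convergence_rate mu L = beta].
Proof.
move=> opt.
have L0 : 0 < L by lra.
have s0 : 0 < Num.sqrt (mu / L) by rewrite sqrtr_gt0 divr_gt0.
have sE : mu = Num.sqrt (mu / L) ^+ 2 * L.
  by rewrite sqr_sqrtr ?divfK ?divr_ge0 ?gt_eqF // ltW.
have s1 : Num.sqrt (mu / L) < 1.
  by rewrite -sqrtr1 ltr_sqrt // ltr_pdivrMr // mul1r.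
set s := Num.sqrt (mu / L) in beta_def s0 sE s1.
(* Both [beta] and the step size thus become rational in [s] and [L], so that [field] can check the
   constraints. *)
have hE : Num.sqrt (mu * L) = s * L.
  by rewrite sE -mulrA -expr2 -exprMn sqrtr_sqr gtr0_norm ?mulr_gt0.
have b0 : 0 <= beta by rewrite beta_def divr_ge0 //; lra.
have b1 : beta < 1 by rewrite beta_def ltr_pdivrMr; lra.
have sn0 : s != 0 by rewrite gt_eqF.
have Ln0 : L != 0 by rewrite gt_eqF.
have s1n0 : 1 + s != 0 by rewrite gt_eqF //; lra.
have obj : objective mu L opt = beta ^+ 2.
  by rewrite /objective /= !mulr0 maxxx addr0.
have feas : feasible mu L opt.
  split; first split=> /=.
  - by rewrite divr_gt0 // hE mulr_gt0.
  - by [].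
  - by rewrite subr0.
  - by rewrite ger0_norm ?sqr_ge0 // expr_lt1.
  rewrite /= hE sE !mulr0 !addr0.
  (* Both discriminants vanish: the double roots are [beta] at [mu], [- beta] at [L]. *)
  have -> : - (1 + beta ^+ 2) + s ^+ 2 * L * (1 / (s * L)) * (1 - beta ^+ 2)
            = - 2 * beta by rewrite beta_def; field; rewrite ?sn0 ?Ln0 ?s1n0.
  have -> : - (1 + beta ^+ 2) + L * (1 / (s * L)) * (1 - beta ^+ 2)
            = 2 * beta by rewrite beta_def; field; rewrite ?sn0 ?Ln0 ?s1n0.
  by split; lra.
have sol : optimal_solution mu L opt.
  split=> // m' fm'; rewrite obj beta_def sE.
  by apply: feasible_objective_ge => //; rewrite -sE.
have val : optimal_value mu L = beta ^+ 2 by rewrite (optimal_valueE sol).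
split=> //.
- by rewrite /rho_poly /= scaleNr.
- by rewrite /sigma_poly /= add0r.
- by rewrite /convergence_rate val sqrtr_sqr ger0_norm.
Qed.
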